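(* Let $X=(X_{ij})\in SO^{+}(2,1)$ be symmetric positive definite. (1) Suppose $X_{11}\neq 1$. For either choice of sign put $y_2=\pm\frac{1}{\sqrt2}\sqrt{X_{11}-1}$, $y_1=-\frac{X_{12}+X_{13}}{2y_2}$, $y_4=\frac{X_{12}-X_{13}}{2y_2}$ and $Y=\begin{pmatrix} y_1 & y_2 \\ y_2 & y_4 \end{pmatrix}$. The two matrices $Y$ obtained from the two choices of sign are negatives of each other, one of them is positive definite, and this positive definite $Y$ lies in $SL(2,\mathbf{R})$ and satisfies $\Phi_{2,1}(Y)=X$. (2) Suppose $X_{11}=1$. Then $Y=\mathrm{diag}(y_1,y_4)$ with $y_1=\sqrt{X_{22}+X_{23}}$ and $y_4=\sqrt{X_{22}-X_{23}}$ is a positive definite element of $SL(2,\mathbf{R})$ with $\Phi_{2,1}(Y)=X$.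
   Context: $I_{2,1}=\mathrm{diag}(1,1,-1)$; $SO(2,1)=\{X\in M(3,\mathbf{R}): X^TI_{2,1}X=I_{2,1},\ \det X=1\}$ and $SO^{+}(2,1)$ is its identity component. The map $\Phi_{2,1}:SL(2,\mathbf{R})\to SO^{+}(2,1)$ is the double covering (a surjective group homomorphism with kernel $\{\pm I\}$) which sends $\begin{pmatrix} y_1 & y_2 \\ y_3 & y_4 \end{pmatrix}$ to $$\begin{pmatrix} 1+2y_2y_3 & y_2y_4-y_1y_3 & -(y_1y_3+y_2y_4) \\ y_3y_4-y_1y_2 & \tfrac12(y_1^2-y_2^2-y_3^2+y_4^2) & \tfrac12(y_1^2+y_2^2-y_3^2-y_4^2) \\ -(y_1y_2+y_3y_4) & \tfrac12(y_1^2-y_2^2+y_3^2-y_4^2) & \tfrac12(y_1^2+y_2^2+y_3^2+y_4^2) \end{pmatrix}.$$ *)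

(* Defs.v *)
From HB Require Import structures.
From mathcomp Require Import all_boot all_order all_algebra.
From mathcomp Require Import all_classical all_reals all_analysis.

Set Implicit Arguments.
Unset Strict Implicit.
Unset Printing Implicit Defensive.

Import Order.TTheory GRing.Theory Num.Theory.
Import numFieldNormedType.Exports.

Local Open Scope classical_set_scope.
Local Open Scope ring_scope.

Definition mx_of_rows (R : realType) (m n : nat) (rows : seq (seq R)) :
    'M[R]_(m, n) :=
  \matrix_(i < m, j < n) (nth [::] rows i)`_j.

Definition I21 (R : realType) : 'M[R]_3 :=
  diag_mx (\row_(j < 3) [:: 1; 1; -1]`_j).

Definition SL2 (R : realType) : set 'M[R]_2 := [set Y | \det Y = 1].
Arguments SL2 R : clear implicits.

Definition SO21 (R : realType) : set 'M[R]_3 :=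
  [set X | X^T *m I21 R *m X = I21 R /\ \det X = 1].
Arguments SO21 R : clear implicits.

(* The ambient topology on 'M[R]_3 is the entrywise (product) topology. *)
Definition SO21_plus (R : realType) : set 'M[R]_3 :=
  connected_component (SO21 R) 1%:M.
Arguments SO21_plus R : clear implicits.

Definition sym_posdef (R : realType) (n : nat) (A : 'M[R]_n) : Prop :=
  A^T = A /\ forall v : 'cV[R]_n, v != 0 -> 0 < (v^T *m A *m v) 0 0.

(* The formula of the covering SL(2,R) -> SO+(2,1), read on all of 'M[R]_2.
   Indices start at 0: y1 = Y 0 0, y2 = Y 0 1, y3 = Y 1 0, y4 = Y 1 1. *)
Definition Phi21 (R : realType) (Y : 'M[R]_2) : 'M[R]_3 :=
  let y1 := Y 0 0 in let y2 := Y 0 1 in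
  let y3 := Y 1 0 in let y4 := Y 1 1 in
  mx_of_rows 3 3
    [:: [:: 1 + 2 * y2 * y3; y2 * y4 - y1 * y3; - (y1 * y3 + y2 * y4)];
        [:: y3 * y4 - y1 * y2;
            2^-1 * (y1 ^+ 2 - y2 ^+ 2 - y3 ^+ 2 + y4 ^+ 2);
            2^-1 * (y1 ^+ 2 + y2 ^+ 2 - y3 ^+ 2 - y4 ^+ 2)];
        [:: - (y1 * y2 + y3 * y4);
            2^-1 * (y1 ^+ 2 - y2 ^+ 2 + y3 ^+ 2 - y4 ^+ 2);
            2^-1 * (y1 ^+ 2 + y2 ^+ 2 + y3 ^+ 2 + y4 ^+ 2)]].

(* The sign of y2 is (-1) ^+ s: plus for s = false, minus for s = true.
   With indices starting at 0, the entries X_11, X_12, X_13 are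
   X 0 0, X 0 1, X 0 2. *)
Definition Ysign (R : realType) (X : 'M[R]_3) (s : bool) : 'M[R]_2 :=
  let y2 := (-1) ^+ s * ((Num.sqrt 2)^-1 * Num.sqrt (X 0 0 - 1)) in
  let y1 := - ((X 0 1 + X 0 2) / (2 * y2)) in
  let y4 := (X 0 1 - X 0 2) / (2 * y2) in
  mx_of_rows 2 2 [:: [:: y1; y2]; [:: y2; y4]].

(* X_22 and X_23 are X 1 1 and X 1 2. *)
Definition Ydiag (R : realType) (X : 'M[R]_3) : 'M[R]_2 :=
  let y1 := Num.sqrt (X 1 1 + X 1 2) in
  let y4 := Num.sqrt (X 1 1 - X 1 2) in
  diag_mx (\row_(j < 2) [:: y1; y4]`_j).

(* Main.v *)
Require Import Defs.
From HB Require Import structures.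
From mathcomp Require Import all_boot all_order all_algebra.
From mathcomp Require Import all_classical all_reals all_analysis.
From mathcomp Require Import ring lra.

Import Order.TTheory GRing.Theory Num.Theory.
Import numFieldNormedType.Exports.

Local Open Scope classical_set_scope.
Local Open Scope ring_scope.

(* For symmetric X in SO(2,1) the inverse of X is both I21 X I21 and the
   adjugate of X.  Equating the two expresses the squares (and one product) of
   the off-diagonal entries through the diagonal; substituting these into
   X11^2 + X12^2 - X13^2 = 1 gives (X11 + 1)(X11 + X22 - X33 - 1) = 0, hence
   X33 = X11 + X22 - 1 by positivity.  Then X12^2 = (X11 - 1)(X22 - 1),
   X13^2 = (X11 - 1)(X11 + X22) and X23^2 = (X22 - 1)(X11 + X22), and the
   entries of Phi(Y) and det Y are evaluated directly, for either sign of y2.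
   As det Y = 1, positive definiteness of Y only requires y1 > 0; and y1 <> 0
   because y1 y4 = 1 + y2^2. *)

Lemma big_ord2 (V : nmodType) (F : 'I_2 -> V) : \sum_i F i = F 0 + F 1.
Proof.
rewrite !big_ord_recl big_ord0 addr0; congr (_ + F _); exact/val_inj.
Qed.

Lemma big_ord3 (V : nmodType) (F : 'I_3 -> V) : \sum_i F i = F 0 + F 1 + F 2.
Proof.
rewrite !big_ord_recl big_ord0 addr0 addrA.
by congr (_ + F _ + F _); apply/val_inj.
Qed.

(** Stated as an eliminator: [elim/forall_ord2] turns an entrywise matrix identity into cases with
    literal indices. *)
Lemma forall_ord2 (P : 'I_2 -> Prop) : P 0 -> P 1 -> forall i, P i.
Proof.
move=> P0 P1 [[|[|//]] lti].
- by rewrite (_ : Ordinal lti = 0) //; apply/val_inj.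
- by rewrite (_ : Ordinal lti = 1) //; apply/val_inj.
Qed.

Lemma forall_ord3 (P : 'I_3 -> Prop) : P 0 -> P 1 -> P 2 -> forall i, P i.
Proof.
move=> P0 P1 P2 [[|[|[|//]]] lti].
- by rewrite (_ : Ordinal lti = 0) //; apply/val_inj.
- by rewrite (_ : Ordinal lti = 1) //; apply/val_inj.
- by rewrite (_ : Ordinal lti = 2) //; apply/val_inj.
Qed.

Lemma det_mx22 (R : comNzRingType) (A : 'M[R]_2) :
  \det A = A 0 0 * A 1 1 - A 0 1 * A 1 0.
Proof.
rewrite (expand_det_row _ 0) big_ord2 /cofactor !det_mx11 !mxE.
have l00 : lift 0 0 = 1 :> 'I_2 by apply/val_inj.
have l10 : lift 1 0 = 0 :> 'I_2 by apply/val_inj.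
rewrite l00 l10 /=; ring.
Qed.

Lemma det_mx33 (R : comNzRingType) (A : 'M[R]_3) :
  \det A = A 0 0 * (A 1 1 * A 2 2 - A 1 2 * A 2 1)
         - A 0 1 * (A 1 0 * A 2 2 - A 1 2 * A 2 0)
         + A 0 2 * (A 1 0 * A 2 1 - A 1 1 * A 2 0).
Proof.
rewrite (expand_det_row _ 0) big_ord3 /cofactor !det_mx22 !mxE.
have l00 : lift 0 0 = 1 :> 'I_3 by apply/val_inj.
have l01 : lift 0 1 = 2 :> 'I_3 by apply/val_inj.
have l10 : lift 1 0 = 0 :> 'I_3 by apply/val_inj.
have l11 : lift 1 1 = 2 :> 'I_3 by apply/val_inj.
have l20 : lift 2 0 = 0 :> 'I_3 by apply/val_inj.
have l21 : lift 2 1 = 1 :> 'I_3 by apply/val_inj.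
rewrite l00 l01 l10 l11 l20 l21 /=; ring.
Qed.

Lemma sym_posdef_diag_gt0 (R : realType) (n : nat) (A : 'M[R]_n) (i : 'I_n) :
  sym_posdef A -> 0 < A i i.
Proof.
case=> _ /(_ (delta_mx i 0)); rewrite trmx_delta -rowE -colE !mxE; apply.
by apply/eqP => /matrixP/(_ i 0)/eqP; rewrite !mxE !eqxx oner_eq0.
Qed.

(** Sylvester's criterion in size two. Multiplying the quadratic form by [A 0 0] and completing the
    square gives [(A 0 0 * x + A 0 1 * y) ^+ 2 + \det A * y ^+ 2]. *)
Lemma sym_posdef2 (R : realType) (A : 'M[R]_2) :
  A 0 1 = A 1 0 -> 0 < A 0 0 -> 0 < \det A -> sym_posdef A.
Proof.
move=> A01 A00; rewrite det_mx22 => dA; split.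
  by apply/matrixP; elim/forall_ord2; elim/forall_ord2; rewrite mxE.
move=> v v0; rewrite mxE big_ord2 !mxE !big_ord2 !mxE -A01.
rewrite -A01 in dA.
set x := v 0 0; set y := v 1 0.
rewrite -(pmulr_rgt0 _ A00).
have -> : A 0 0 * ((x * A 0 0 + y * A 0 1) * x + (x * A 0 1 + y * A 1 1) * y)
  = (A 0 0 * x + A 0 1 * y) ^+ 2 + (A 0 0 * A 1 1 - A 0 1 * A 0 1) * y ^+ 2.
  by ring.
have [y0|y0] := eqVneq y 0.
  have x0 : x != 0.
    apply: contra v0 => /eqP x0; apply/eqP/matrixP => i j; rewrite mxE ord1.
    by elim/forall_ord2: i.
  rewrite y0 !mulr0 expr0n mulr0 !addr0 exprn_even_gt0 //=.
  exact: (mulf_neq0 (lt0r_neq0 A00) x0).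
by rewrite ltr_wpDl ?sqr_ge0 // mulr_gt0 // exprn_even_gt0.
Qed.

Lemma sym_SO21_entries (R : realType) (X : 'M[R]_3) :
    SO21 R X -> X^T = X -> 0 < X 0 0 ->
  [/\ X 2 2 = X 0 0 + X 1 1 - 1,
      X 0 1 ^+ 2 = (X 0 0 - 1) * (X 1 1 - 1),
      X 0 2 ^+ 2 = (X 0 0 - 1) * (X 0 0 + X 1 1),
      X 1 2 ^+ 2 = (X 1 1 - 1) * (X 0 0 + X 1 1)
    & X 0 1 * X 0 2 = (X 0 0 - 1) * X 1 2].
Proof.
move=> [XJ detX] symX a0.
have sX i j : X j i = X i j by rewrite -{1}symX mxE.
have E i j : X 0 i * X 0 j + X 1 i * X 1 j - X 2 i * X 2 j = I21 R i j.
  by rewrite -XJ mxE big_ord3 !mxE !big_ord3 !mxE /=; ring.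
move: detX; rewrite det_mx33.
move: (E 0 0) (E 0 1) (E 0 2) (E 1 1) (E 1 2) (E 2 2).
rewrite !mxE (sX 0 1) (sX 0 2) (sX 1 2) /= !(mulr1n, mulr0n).
move: a0; set a := X 0 0; set b := X 0 1; set c := X 0 2.
set d := X 1 1; set e := X 1 2; set f := X 2 2.
move=> a0 E00 E01 E02 E11 E12 E22 D.
(* Each of the next four identities is an entry of [\det X *: (I21 R *m X) = \adj X *m I21 R]. A row
   of cofactors is paired with a column of [X^T *m I21 R *m X]: the relations [E] evaluate the
   pairing to one signed cofactor, while expanding it produces the determinant times an entry of
   [X]. *)
have Ca : d * f - e ^+ 2 = a.
  rewrite -[RHS]mulr1 -D.
  transitivity ((d * f - e ^+ 2) * (a * a + b * b - c * c)
    + (c * e - b * f) * (a * b + b * d - c * e)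
    + (b * e - c * d) * (a * c + b * e - c * f)); last by ring.
  by rewrite E00 E01 E02; ring.
have Cd : a * f - c ^+ 2 = d.
  rewrite -[RHS]mulr1 -D.
  transitivity ((c * e - b * f) * (a * b + b * d - c * e)
    + (a * f - c ^+ 2) * (b * b + d * d - e * e)
    + (b * c - a * e) * (b * c + d * e - e * f)); last by ring.
  by rewrite E11 E01 E12; ring.
have Cf : a * d - b ^+ 2 = f.
  rewrite -[RHS]mulr1 -D.
  transitivity (- ((b * e - c * d) * (a * c + b * e - c * f)
    + (b * c - a * e) * (b * c + d * e - e * f)
    + (a * d - b ^+ 2) * (c * c + e * e - f * f))); last by ring.
  by rewrite E02 E12 E22; ring.
have Ce : a * e - b * c = e.
  rewrite -[RHS]mulr1 -D.
  transitivity ((c * e - b * f) * (a * c + b * e - c * f)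
    + (a * f - c ^+ 2) * (b * c + d * e - e * f)
    + (b * c - a * e) * (c * c + e * e - f * f)); last by ring.
  by rewrite E02 E12 E22; ring.
have t1 : f = a + d - 1.
  have : (a + 1) * (a + d - f - 1) = 0 by lra.
  by move=> /eqP; rewrite mulf_eq0 => /orP[] /eqP; lra.
by rewrite t1 in Ca Cd Cf *; split; lra.
Qed.

Lemma Ysign_true (R : realType) (X : 'M[R]_3) : Ysign X true = - Ysign X false.
Proof.
apply/matrixP; elim/forall_ord2; elim/forall_ord2; rewrite !mxE /= expr0 expr1.
all: by rewrite ?(mulN1r, mul1r, mulrN, invrN, opprK).
Qed.

Lemma Ysign_det_Phi (R : realType) (X : 'M[R]_3) (s : bool) :
    SO21 R X -> sym_posdef X -> 1 < X 0 0 ->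
  \det (Ysign X s) = 1 /\ Phi21 (Ysign X s) = X.
Proof.
move=> XSO Xpos a1.
have [Ef Eb Ec Ee Ebc] :=
  sym_SO21_entries _ _ XSO Xpos.1 (sym_posdef_diag_gt0 _ _ _ 0 Xpos).
have sX i j : X j i = X i j by rewrite -{1}Xpos.1 mxE.
rewrite det_mx22 /Phi21 !mxE /=.
set y := (-1) ^+ s * _.
have y2 : 2 * y ^+ 2 = X 0 0 - 1.
  rewrite !exprMn sqrr_sign mul1r exprVn !sqr_sqrtr ?ler0n ?subr_ge0 ?ltW //.
  by rewrite mulVKf ?pnatr_eq0.
have a10 : X 0 0 - 1 != 0 by rewrite subr_eq0 gt_eqF.
have y0 : y != 0.
  by apply: contraNneq a10 => y0; rewrite -y2 y0 expr0n mulr0.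
set b := X 0 1 in Eb Ebc *; set c := X 0 2 in Ec Ebc *.
(* The determinant and the entries of [Phi21] are of even degree in the entries of [Y], so [y]
   enters only through [y ^+ 2] and its sign drops out. *)
have q1 : (- ((b + c) / (2 * y))) ^+ 2 = (b + c) ^+ 2 / (2 * (X 0 0 - 1)).
  by rewrite -y2; field.
have q4 : ((b - c) / (2 * y)) ^+ 2 = (b - c) ^+ 2 / (2 * (X 0 0 - 1)).
  by rewrite -y2; field.
have q14 : - ((b + c) / (2 * y)) * ((b - c) / (2 * y)) =
    (X 0 2 ^+ 2 - X 0 1 ^+ 2) / (2 * (X 0 0 - 1)).
  by rewrite -y2 -/b -/c; field.
have q1' : - ((b + c) / (2 * y)) * y = - (b + c) / 2 by field.
have q4' : ((b - c) / (2 * y)) * y = (b - c) / 2 by field.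
move: q1 q4 q14 q1' q4'.
set y1 := - ((b + c) / (2 * y)); set y4 := (b - c) / (2 * y) => q1 q4 q14 q1' q4'.
(* The relations for [b ^+ 2], [c ^+ 2] and [b * c] all carry the factor [X 0 0 - 1], which cancels
   the denominator. *)
have sum : y1 ^+ 2 + y4 ^+ 2 = X 0 0 + 2 * X 1 1 - 1.
  rewrite q1 q4.
  transitivity ((b ^+ 2 + c ^+ 2) / (X 0 0 - 1)); first by field.
  by rewrite Eb Ec; field.
have dif : y1 ^+ 2 - y4 ^+ 2 = 2 * X 1 2.
  rewrite q1 q4.
  transitivity (2 * (b * c) / (X 0 0 - 1)); first by field.
  by rewrite Ebc; field.
split.
  by rewrite q14 Eb Ec -expr2 (_ : y ^+ 2 = (X 0 0 - 1) / 2); [field | lra].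
apply/matrixP; elim/forall_ord3; elim/forall_ord3; rewrite !mxE /=.
(* Every entry is now linear in the quadratic monomials fixed by [y2], [sum], [dif], [q1'] and
   [q4']. *)
all: rewrite ?(sX 0 1) ?(sX 0 2) ?(sX 1 2) ?Ef -/b -/c; lra.
Qed.

Theorem mainTheorem4 (R : realType) (X : 'M[R]_3)
    (hX : SO21_plus R X) (hpos : sym_posdef X) :
  (X 0 0 <> 1 ->
     [/\ Ysign X true = - Ysign X false,
         exists s : bool, sym_posdef (Ysign X s)
       & forall s : bool, sym_posdef (Ysign X s) ->
           SL2 R (Ysign X s) /\ Phi21 (Ysign X s) = X])
  /\
  (X 0 0 = 1 ->
     [/\ sym_posdef (Ydiag X), SL2 R (Ydiag X) & Phi21 (Ydiag X) = X]).
Proof.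
have XSO : SO21 R X by apply: connected_component_sub hX.
have pX i := sym_posdef_diag_gt0 _ _ _ i hpos.
have [Ef Eb Ec Ee Ebc] := sym_SO21_entries _ _ XSO hpos.1 (pX 0).
have sX i j : X j i = X i j by rewrite -{1}hpos.1 mxE.
split=> a1.
  (* [X 0 2 ^+ 2 = (X 0 0 - 1) * (X 0 0 + X 1 1)] is nonnegative and its second factor is
     positive. *)
  have {}a1 : 1 < X 0 0.
    rewrite lt_neqAle eq_sym; apply/andP; split; first exact/eqP.
    rewrite -subr_ge0 -(pmulr_lge0 _ (addr_gt0 (pX 0) (pX 1))) -Ec.
    exact: sqr_ge0.
  have YP s := Ysign_det_Phi _ _ s XSO hpos a1.
  split; [exact: Ysign_true | | by move=> s _; exact: YP].
  have Y00 : Ysign X false 0 0 != 0.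
    apply/eqP => Y00; have := (YP false).1.
    have Ysym : Ysign X false 1 0 = Ysign X false 0 1 by rewrite !mxE.
    have := sqr_ge0 (Ysign X false 0 1).
    by rewrite det_mx22 Y00 Ysym mul0r sub0r expr2; lra.
  have Ypos s : 0 < Ysign X s 0 0 -> sym_posdef (Ysign X s).
    by move=> ?; apply: sym_posdef2; rewrite ?(YP s).1 ?ltr01 // !mxE.
  (* Changing the sign of [y2] negates the corner entry, so exactly one choice makes it positive. *)
  have [Y_lt0|Y_gt0|/eqP] := ltgtP (Ysign X false 0 0) 0.
  - by exists true; apply: Ypos; rewrite Ysign_true mxE oppr_gt0.
  - by exists false; exact: Ypos.
  - by rewrite (negPf Y00).
rewrite a1 subrr mul0r in Eb Ec.
have b0 : X 0 1 = 0 by apply/eqP; rewrite -sqrf_eq0 Eb.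
have c0 : X 0 2 = 0 by apply/eqP; rewrite -sqrf_eq0 Ec mul0r.
have d0 := pX 1.
(* With [X 0 0 = 1] the relation for [X 1 2 ^+ 2] reads [X 1 2 ^+ 2 = X 1 1 ^+ 2 - 1]. *)
have prod : (X 1 1 + X 1 2) * (X 1 1 - X 1 2) = 1 by rewrite a1 in Ee; lra.
(* The two factors have product 1 and sum [2 * X 1 1 > 0], so both are positive. *)
have [p1 p4] : 0 < X 1 1 + X 1 2 /\ 0 < X 1 1 - X 1 2 by split; nra.
have detY : \det (Ydiag X) = 1.
  by rewrite det_diag big_ord_recl big_ord1 !mxE /= -sqrtrM ?ltW // prod sqrtr1.
have Y01 : Ydiag X 0 1 = 0 by rewrite !mxE.
have Y10 : Ydiag X 1 0 = 0 by rewrite !mxE.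
have Y00 : Ydiag X 0 0 = Num.sqrt (X 1 1 + X 1 2) by rewrite !mxE.
have Y11 : Ydiag X 1 1 = Num.sqrt (X 1 1 - X 1 2) by rewrite !mxE.
split=> //.
  by apply: sym_posdef2; rewrite ?Y01 ?Y10 ?detY ?Y00 ?sqrtr_gt0.
rewrite /Phi21 Y01 Y10 Y00 Y11.
apply/matrixP; elim/forall_ord3; elim/forall_ord3; rewrite !mxE /=.
all: rewrite ?sqr_sqrtr ?(ltW p1) ?(ltW p4) //.
all: rewrite ?(sX 0 1) ?(sX 0 2) ?(sX 1 2) ?Ef; lra.
Qed.
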